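(* There are absolute constants $c_6,c_8>0$ such that the following holds for all sufficiently large $n$ (the lower bound on $n$ being independent of $k$). Let $1\le k\le n^{1/3}$, and let $G$ be an $n$-vertex graph with $$e(G)\ge \frac{n^2}{k}.$$ Then $G$ contains subgraphs $H_6,H_8$ satisfying $$e(H_6)\ge c_6\frac{n^2}{k^3},\qquad e(H_8)\ge c_8\frac{n^2}{k^2},$$ such that $H_6$ is internally $C_{\le 6}$-connected and $H_8$ is internally $C_{\le 8}$-connected. Consequently, for every fixed $0<\beta\le 1/3$, every sufficiently large $n$-vertex graph with at least $n^{2-\beta}$ edges contains internally $C_{\le6}$- and $C_{\le8}$-connected subgraphs with $\Omega(n^{2-3\beta})$ and $\Omega(n^{2-2\beta})$ edges, respectively.
   Context: All graphs are finite and simple; $e(G)$ is the number of edges. A cycle is a simple cycle, not necessarily induced. The parameter $k$ is a real number. Implicit constants in $\Omega(\cdot)$ are absolute. A graph $H$ (subgraph of $G$) is internally $C_{\le r}$-connected if every two distinct edges of $H$ lie together on a cycle of length at most $r$ contained in $H$. *)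

(* Defs.v *)
From HB Require Import structures.
From mathcomp Require Import all_boot.

Set Implicit Arguments.
Unset Strict Implicit.
Unset Printing Implicit Defensive.

(* A finite simple graph with vertices in the ambient finite type [T]; the
   vertex set need not be all of [T], so that a graph and its subgraphs are
   objects of the same type. *)
Record sgraph (T : finType) := SGraph {
  vset : {set T};
  eset : {set {set T}};
  esetP : forall f, f \in eset -> #|f| = 2 /\ f \subset vset
}.

Section Graphs.
Variable T : finType.
Implicit Types (G H : sgraph T) (c : seq T) (r : nat).

Definition num_edges G : nat := #|eset G|.

Definition subgraph H G : bool :=
  (vset H \subset vset G) && (eset H \subset eset G).

Definition adj G : rel T := fun x y => [set x; y] \in eset G.

(* [c] lists the vertices in cyclic order, so the length is [size c]; the bound
   on the size excludes a single edge traversed back and forth, which [ucycleb]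
   accepts. *)
Definition is_cycle G c : bool := (2 < size c) && ucycleb (adj G) c.

Definition cycle_edges c : {set {set T}} := [set [set x; next c x] | x in c].

Definition internally_cycle_connected r H : Prop :=
  forall f g : {set T}, f \in eset H -> g \in eset H -> f != g ->
  exists c : seq T, [/\ is_cycle H c, size c <= r,
                        f \in cycle_edges c & g \in cycle_edges c].

End Graphs.

(* Main.v *)
Require Import Defs.
From HB Require Import structures.
From mathcomp Require Import all_boot all_order all_algebra.
From mathcomp Require Import reals exp.
From mathcomp Require Import zify lra ring.

Set Implicit Arguments.
Unset Strict Implicit.
Unset Printing Implicit Defensive.

Import Order.TTheory GRing.Theory Num.Theory.

Local Open Scope ring_scope.

(* After passing to a bipartite subgraph of minimum degree at least d = n/(8k):

   H6. For v and u on opposite sides, any two disjoint edges ab, a'b' with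
   a, a' in N(v) and b, b' in N(u) lie on the 6-cycle v a b u b' a'.  By double
   counting of walks of length 3, some pair (v, u) has about d^3/n such edges.

   H8. Let U, Z be disjoint subsets of N(v) such that every u in U and z in Z
   have at least 4 common neighbours, and let B be the set of vertices adjacent
   to both U and Z.  The common neighbours of u and z' and those of u' and z are
   again in B and close two paths z b u and z' b' u' up to an 8-cycle, so the
   edges between B and U + Z form an internally C_{<=8}-connected graph.  Pairs
   in N(v) with fewer than 4 common neighbours are few for an average v: a vertex
   of N(v) is typically in O(k) of them, whereas a second neighbour b of v has of
   order n/k^2 >= k neighbours in N(v).  Hence U can be chosen greedily so that
   it is adjacent to a positive proportion of the b's, while its bad partners,
   which are excluded from Z, carry only part of the edges. *)

(** * Alternating cycles in a bipartite subgraph *)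

(* [F x y] is oriented: [x] is on the side [X] and [y] on the side [Y]. *)
Section BipartiteSubgraph.
Variables (T : finType) (G : sgraph T) (F : rel T).

Definition spanned_edges : {set {set T}} :=
  [set f in eset G | [exists x, [exists y, F x y && (f == [set x; y])]]].

Lemma spanned_edgesP f :
  f \in spanned_edges -> #|f| = 2 /\ f \subset vset G.
Proof. by rewrite inE => /andP[/esetP]. Qed.

(** All vertices of [G] are kept: internal connectivity only concerns edges. *)
Definition spanned : sgraph T := SGraph spanned_edgesP.

Lemma spanned_subgraph : subgraph spanned G.
Proof. by rewrite /subgraph subxx; apply/subsetP => f; rewrite inE => /andP[]. Qed.

Variables X Y : {set T}.
Hypothesis disjXY : [disjoint X & Y].
Hypothesis FXY : forall x y, F x y -> (x \in X) && (y \in Y).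
Hypothesis FG : forall x y, F x y -> [set x; y] \in eset G.

Lemma sides_neq x y : x \in X -> y \in Y -> x != y.
Proof. by move=> xX yY; apply: contraTneq yY => <-; rewrite (disjointFr disjXY). Qed.

Lemma spanned_adj x y : F x y -> adj spanned x y.
Proof.
move=> Fxy; rewrite /adj inE FG //=.
by apply/existsP; exists x; apply/existsP; exists y; rewrite Fxy /=.
Qed.

Lemma spanned_adjC x y : F x y -> adj spanned y x.
Proof. by move=> /spanned_adj; rewrite /adj setUC. Qed.

Lemma spanned_edgeP f :
  f \in eset spanned -> exists x y, F x y /\ f = [set x; y].
Proof.
rewrite inE => /andP[_ /existsP[x /existsP[y /andP[Fxy /eqP->]]]].
by exists x, y.
Qed.

(** Since [X] and [Y] are disjoint, an edge determines which endpoint comes first, so sending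
    [(x, y)] to [[set x; y]] is injective on [F]. *)
Lemma num_edges_spanned : num_edges spanned = (\sum_x \sum_y F x y)%N.
Proof.
have -> : (\sum_x \sum_y F x y)%N = #|[set p : T * T | F p.1 p.2]|.
  rewrite pair_big -sum1_card big_mkcond [RHS]big_mkcond /=.
  by apply: eq_bigr => p _; rewrite inE; case: (F _ _).
rewrite /num_edges /=.
have -> : spanned_edges = [set [set p.1; p.2] | p in [set p : T * T | F p.1 p.2]].
  apply/setP => f; apply/idP/imsetP.
    by case/spanned_edgeP => x [y [Fxy ->]]; exists (x, y); rewrite ?inE.
  case=> -[x y]; rewrite inE /= => Fxy ->; exact: (spanned_adj Fxy).
rewrite card_in_imset // => -[x y] [x' y']; rewrite !inE /= => Fxy Fxy' eq2.
have /andP[xX yY] := FXY Fxy; have /andP[xX' yY'] := FXY Fxy'.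
have: x \in [set x'; y'] by rewrite -eq2 !inE eqxx.
rewrite !inE (negPf (sides_neq xX yY')) orbF => /eqP->.
have: y \in [set x'; y'] by rewrite -eq2 !inE eqxx orbT.
by rewrite !inE eq_sym (negPf (sides_neq xX' yY)) /= => /eqP->.
Qed.

Definition linked r (p q : T * T) : Prop :=
  exists c, [/\ is_cycle spanned c, (size c <= r)%N,
    [set p.1; p.2] \in cycle_edges c & [set q.1; q.2] \in cycle_edges c].

Lemma linkedC r p q : linked r p q -> linked r q p.
Proof. by case=> c [? ? ? ?]; exists c. Qed.

Lemma linkedW r r' p q : (r <= r')%N -> linked r p q -> linked r' p q.
Proof. by move=> le_r [c [? le_c ? ?]]; exists c; split=> //; apply: leq_trans le_r. Qed.

Lemma spanned_connected r :
  (forall p q, F p.1 p.2 -> F q.1 q.2 -> p != q -> linked r p q) ->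
  internally_cycle_connected r spanned.
Proof.
move=> lnk f g /spanned_edgeP[x [y [Fxy ->]]] /spanned_edgeP[x' [y' [Fxy' ->]]].
move=> neq; apply: (lnk (x, y) (x', y')) => //.
by apply: contraNneq neq => -[-> ->].
Qed.

(** Zipping [c] with its rotation lists the consecutive pairs, so that for a concrete cycle the
    edges form a concrete list. *)
Lemma cycle_edges_zip (c : seq T) x y : uniq c ->
  (x, y) \in zip c (rot 1 c) -> [set x; y] \in cycle_edges c.
Proof.
case: c => [|z c] // uc; rewrite rot1_cons => /(nthP (x, x))[i].
rewrite size_zip size_rcons minnn => ic; rewrite nth_zip ?size_rcons // => -[ex ey].
have memc : x \in z :: c by rewrite -ex mem_nth.
apply/imsetP; exists x => //; congr [set _; _].
rewrite next_nth memc -[in index _ _]ex index_uniq // -ey nth_rcons.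
(* At the last index the cycle wraps around: [nth] runs past the tail and returns its default, the
   first vertex [z]. *)
move: ic; rewrite /= ltnS leq_eqVlt => /predU1P[->|ic].
  by rewrite ltnn eqxx nth_default.
by rewrite ic; apply: set_nth_default.
Qed.

(** Pairs have their end in [X] first, but a cycle traverses every other edge from [Y] to [X]; hence
    reversed pairs are accepted. *)
Lemma cycle_linked r (c : seq T) p q : uniq c -> (2 < size c <= r)%N ->
    cycle (adj spanned) c ->
    let ce := zip c (rot 1 c) in
    (p \in ce) || ((p.2, p.1) \in ce) -> (q \in ce) || ((q.2, q.1) \in ce) ->
  linked r p q.
Proof.
move=> uc /andP[c2 cr] cc ce.
have mem_ce s : (s \in ce) || ((s.2, s.1) \in ce) -> [set s.1; s.2] \in cycle_edges c.
  case/orP => [|/(cycle_edges_zip uc)]; last by rewrite setUC.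
  by case: s => x y; apply: cycle_edges_zip.
move=> /mem_ce pc /mem_ce qc; exists c; split=> //.
by rewrite /is_cycle c2 /ucycleb cc.
Qed.

(** Distinctness along an alternating cycle need only be checked on each side. *)
Lemma bipartite_uniq (xs ys c : seq T) : uniq xs -> uniq ys ->
  all (mem X) xs -> all (mem Y) ys -> perm_eq c (xs ++ ys) -> uniq c.
Proof.
move=> uxs uys /allP Xxs /allP Yys /perm_uniq->; rewrite cat_uniq uxs uys andbT /=.
apply/hasPn => y /Yys yY; apply/negP => /Xxs xX.
by have := sides_neq xX yY; rewrite eqxx.
Qed.

Lemma linked4 x1 y1 x2 y2 p q :
    F x1 y1 -> F x2 y1 -> F x2 y2 -> F x1 y2 ->
    uniq [:: x1; x2] -> uniq [:: y1; y2] ->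
    let es := [:: (x1, y1); (x2, y1); (x2, y2); (x1, y2)] in
    p \in es -> q \in es -> linked 4 p q.
Proof.
move=> F11 F21 F22 F12 ux uy es pes qes.
have [/andP[X1 Y1] /andP[X2 Y2]] := (FXY F11, FXY F22).
apply: (@cycle_linked _ [:: x1; y1; x2; y2]) => //.
- apply: (bipartite_uniq ux uy); last by apply/permP => a /=; ring.
    by rewrite /= X1 X2.
  by rewrite /= Y1 Y2.
- by rewrite /= (spanned_adj F11) (spanned_adjC F21) (spanned_adj F22) (spanned_adjC F12).
- by move: pes; rewrite !inE => /or4P[] /eqP->; rewrite !eqxx ?orbT.
- by move: qes; rewrite !inE => /or4P[] /eqP->; rewrite !eqxx ?orbT.
Qed.

Lemma linked6 x1 y1 x2 y2 x3 y3 p q :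
    F x1 y1 -> F x2 y1 -> F x2 y2 -> F x3 y2 -> F x3 y3 -> F x1 y3 ->
    uniq [:: x1; x2; x3] -> uniq [:: y1; y2; y3] ->
    let es := [:: (x1, y1); (x2, y1); (x2, y2); (x3, y2); (x3, y3); (x1, y3)] in
    p \in es -> q \in es -> linked 6 p q.
Proof.
move=> F11 F21 F22 F32 F33 F13 ux uy es pes qes.
have [[/andP[X1 Y1] /andP[X2 Y2]] /andP[X3 Y3]] := (FXY F11, FXY F22, FXY F33).
apply: (@cycle_linked _ [:: x1; y1; x2; y2; x3; y3]) => //.
- apply: (bipartite_uniq ux uy); last by apply/permP => a /=; ring.
    by rewrite /= X1 X2 X3.
  by rewrite /= Y1 Y2 Y3.
- by rewrite /= (spanned_adj F11) (spanned_adjC F21) (spanned_adj F22)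
    (spanned_adjC F32) (spanned_adj F33) (spanned_adjC F13).
- by move: pes; rewrite !inE -!orbA => /or4P[|||/or3P[]] /eqP->; rewrite !eqxx ?orbT.
- by move: qes; rewrite !inE -!orbA => /or4P[|||/or3P[]] /eqP->; rewrite !eqxx ?orbT.
Qed.

Lemma linked8 x1 y1 x2 y2 x3 y3 x4 y4 p q :
    F x1 y1 -> F x2 y1 -> F x2 y2 -> F x3 y2 ->
    F x3 y3 -> F x4 y3 -> F x4 y4 -> F x1 y4 ->
    uniq [:: x1; x2; x3; x4] -> uniq [:: y1; y2; y3; y4] ->
    let es := [:: (x1, y1); (x2, y1); (x2, y2); (x3, y2);
                  (x3, y3); (x4, y3); (x4, y4); (x1, y4)] in
    p \in es -> q \in es -> linked 8 p q.
Proof.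
move=> F11 F21 F22 F32 F33 F43 F44 F14 ux uy es pes qes.
have [/andP[X1 Y1] /andP[X2 Y2]] := (FXY F11, FXY F22).
have [/andP[X3 Y3] /andP[X4 Y4]] := (FXY F33, FXY F44).
apply: (@cycle_linked _ [:: x1; y1; x2; y2; x3; y3; x4; y4]) => //.
- apply: (bipartite_uniq ux uy); last by apply/permP => a /=; ring.
    by rewrite /= X1 X2 X3 X4.
  by rewrite /= Y1 Y2 Y3 Y4.
- by rewrite /= (spanned_adj F11) (spanned_adjC F21) (spanned_adj F22)
    (spanned_adjC F32) (spanned_adj F33) (spanned_adjC F43) (spanned_adj F44) (spanned_adjC F14).
- by move: pes; rewrite !inE -!orbA => /or4P[|||/or4P[|||/orP[]]] /eqP->; rewrite !eqxx ?orbT.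
- by move: qes; rewrite !inE -!orbA => /or4P[|||/or4P[|||/orP[]]] /eqP->; rewrite !eqxx ?orbT.
Qed.

End BipartiteSubgraph.

(** * Internally connected configurations *)

Section ConnectedStructures.
Variables (T : finType) (G : sgraph T) (E : rel T) (X Y : {set T}).
Hypothesis disjXY : [disjoint X & Y].
Hypothesis EXY : forall x y, E x y -> (x \in X) && (y \in Y).
Hypothesis EG : forall x y, E x y -> [set x; y] \in eset G.

(** * The union of the paths of length 3 between two fixed vertices *)

Section SixCycles.
Variables v u : T.

(** Middle edges of paths [v a b u]; vertices on opposite sides differ anyway, so two inequalities
    suffice. *)
Definition middle b a := [&& E v a, E b a, E b u, a != u & b != v].

Definition star b a := [:: (v, a); (b, a); (b, u)].

Definition middle_stars x y :=
  [exists b, [exists a, middle b a && ((x, y) \in star b a)]].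

Lemma middle_starsP p :
  reflect (exists b a, middle b a /\ p \in star b a) (middle_stars p.1 p.2).
Proof.
case: p => x y /=; apply: (iffP existsP) => [[b /existsP[a /andP[]]]|].
  by exists b, a.
by move=> [b [a [Mba pS]]]; exists b; apply/existsP; exists a; rewrite Mba.
Qed.

Lemma star_middle_stars b a p :
  middle b a -> p \in star b a -> middle_stars p.1 p.2.
Proof. by move=> Mba pS; apply/middle_starsP; exists b, a. Qed.

Lemma middle_stars_edge x y : middle_stars x y -> E x y.
Proof.
case/(middle_starsP (x, y)) => b [a [/and5P[Eva Eba Ebu _ _]]].
by rewrite !inE => /or3P[] /eqP[-> ->].
Qed.

Hypothesis disjoint_middle : forall b a, middle b a ->
  exists b' a', [/\ middle b' a', b' != b & a' != a].

(** Two paths with disjoint middle edges form a 6-cycle, and edges of a single path use a second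
    path from [disjoint_middle]. When the middle edges share just one vertex, the given edges lie on
    one path or on a 4-cycle. *)
Lemma middle_stars_connected :
  internally_cycle_connected 6 (spanned G middle_stars).
Proof.
have FXY x y : middle_stars x y -> (x \in X) && (y \in Y).
  by move/middle_stars_edge/EXY.
have FG x y : middle_stars x y -> [set x; y] \in eset G.
  by move/middle_stars_edge/EG.
have FM b a x y : middle b a -> (x, y) \in star b a -> middle_stars x y.
  by move=> Mba; apply: (@star_middle_stars b a (x, y)).
have link2 b a b' a' p q : middle b a -> middle b' a' -> b' != b -> a' != a ->
    p \in star b a ++ star b' a' -> q \in star b a ++ star b' a' ->
    linked G middle_stars 6 p q.
  move=> M1 M2 nb na pS qS.
  have [[_ _ _ nau nbv] [_ _ _ nau' nbv']] := (and5P M1, and5P M2).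
  have sub : {subset star b a ++ star b' a' <=
      [:: (v, a); (b, a); (b, u); (b', u); (b', a'); (v, a')]}.
    by move=> r; rewrite mem_cat /star !inE -!orbA => /or4P[|||/or3P[]] ->; rewrite ?orbT.
  apply: (linked6 disjXY FXY FG (x1 := v) (y1 := a) (x2 := b) (y2 := u)
    (x3 := b') (y3 := a')); try exact: sub.
  1,2,3: by apply: FM M1 _; rewrite !inE eqxx ?orbT.
  1,2,3: by apply: FM M2 _; rewrite !inE eqxx ?orbT.
  - by rewrite /= !inE !(eq_sym v) (negPf nbv) (negPf nbv') eq_sym nb.
  - by rewrite /= !inE !(eq_sym u) (negPf nau) (negPf nau') eq_sym na.
have link1 b a p q : middle b a -> p \in star b a -> q \in star b a ->
    linked G middle_stars 6 p q.
  move=> M1 pS qS; have [b' [a' [M2 nb na]]] := disjoint_middle M1.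
  by apply: (link2 b a b' a') => //; rewrite mem_cat ?pS ?qS.
apply: spanned_connected => p q /middle_starsP[b [a [M1 pS]]].
case/middle_starsP => b' [a' [M2 qS]] _.
have [eb|nb] := eqVneq b' b; have [ea|na] := eqVneq a' a; first last.
- by apply: (link2 b a b' a'); rewrite ?mem_cat ?pS ?qS ?orbT.
- subst a'.
  have [pS'|pS'] := boolP (p \in star b' a); first exact: link1 M2 _ _.
  have [qS'|qS'] := boolP (q \in star b a); first exact: link1 M1 _ _.
  (* Neither [p] nor [q] is the shared edge [(v, a)]; the others form the 4-cycle [b a b' u]. *)
  apply: (@linkedW _ _ _ 4) => //.
  apply: (linked4 disjXY FXY FG (x1 := b) (y1 := a) (x2 := b') (y2 := u)).
  + by apply: FM M1 _; rewrite !inE eqxx ?orbT.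
  + by apply: FM M2 _; rewrite !inE eqxx ?orbT.
  + by apply: FM M2 _; rewrite !inE eqxx ?orbT.
  + by apply: FM M1 _; rewrite !inE eqxx ?orbT.
  + by rewrite /= inE eq_sym nb.
  + by have [_ _ _ nau _] := and5P M1; rewrite /= inE nau.
  + move: pS pS'; rewrite !inE => /or3P[] /eqP->; rewrite ?eqxx ?orbT //.
  + move: qS qS'; rewrite !inE => /or3P[] /eqP->; rewrite ?eqxx ?orbT //.
- subst b'.
  have [pS'|pS'] := boolP (p \in star b a'); first exact: link1 M2 _ _.
  have [qS'|qS'] := boolP (q \in star b a); first exact: link1 M1 _ _.
  (* Now [(b, u)] is the shared edge, and the others form the 4-cycle [b a v a']. *)
  apply: (@linkedW _ _ _ 4) => //.
  apply: (linked4 disjXY FXY FG (x1 := b) (y1 := a) (x2 := v) (y2 := a')).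
  + by apply: FM M1 _; rewrite !inE eqxx ?orbT.
  + by apply: FM M1 _; rewrite !inE eqxx ?orbT.
  + by apply: FM M2 _; rewrite !inE eqxx ?orbT.
  + by apply: FM M2 _; rewrite !inE eqxx ?orbT.
  + by have [_ _ _ _ nbv] := and5P M1; rewrite /= inE nbv.
  + by rewrite /= inE eq_sym na.
  + move: pS pS'; rewrite !inE => /or3P[] /eqP->; rewrite ?eqxx ?orbT //.
  + move: qS qS'; rewrite !inE => /or3P[] /eqP->; rewrite ?eqxx ?orbT //.
- by subst b' a'; apply: link1 M1 _ _.
Qed.

Lemma middle_stars_size :
  (\sum_b \sum_a middle b a <= num_edges (spanned G middle_stars))%N.
Proof.
rewrite (num_edges_spanned disjXY).
- apply: leq_sum => b _; apply: leq_sum => a _.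
  have [M|//] := boolP (middle b a).
  by rewrite (@star_middle_stars b a (b, a)) // !inE eqxx orbT.
- by move=> x y /middle_stars_edge/EXY.
- by move=> x y /middle_stars_edge/EG.
Qed.

End SixCycles.

(** * Forks between two sets of neighbours of a vertex *)

Section EightCycles.
Variables (F : rel T) (v : T).
Hypothesis FXY : forall x y, F x y -> (x \in X) && (y \in Y).
Hypothesis FG : forall x y, F x y -> [set x; y] \in eset G.

Let Flinked := linked G F.

(** Four common neighbours in [F], in the form used below: one lies outside any list of three
    vertices. *)
Definition rich (U Z : {set T}) : Prop :=
  [/\ [disjoint U & Z], forall w, w \in U :|: Z -> F v w &
      forall u z (s : seq T), u \in U -> z \in Z -> (size s <= 3)%N ->
        exists b, [/\ F b u, F b z & b \notin s]].

Lemma richC U Z : rich U Z -> rich Z U.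
Proof.
move=> [disj Fv com]; split; first by rewrite disjoint_sym.
  by move=> w; rewrite setUC; apply: Fv.
by move=> u z s uU zZ sz; have [b []] := com z u s zZ uU sz; exists b.
Qed.

Lemma rich_neq U Z u z : rich U Z -> u \in U -> z \in Z -> u != z.
Proof. by case=> disj _ _ uU zZ; apply: contraTneq zZ => <-; rewrite (disjointFr disj). Qed.

Definition fork b u z := F b u && F b z.

(** Crossing over, [y] joins [u] to [z'] and [y'] joins [u'] to [z], which gives the 8-cycle
    [b u y z' b' u' y' z]. The choice of [y'] avoids [b], [b'] and [y], whence the bound 3 in
    [rich]. *)
Lemma forks_distinct U Z b u z b' u' z' p q : rich U Z ->
    u \in U -> z \in Z -> u' \in U -> z' \in Z -> fork b u z -> fork b' u' z' ->
    b != b' -> u != u' -> z != z' ->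
    p \in [:: (b, u); (b, z)] -> q \in [:: (b', u'); (b', z')] ->
  Flinked 8 p q.
Proof.
move=> R uU zZ uU' zZ' /andP[Fbu Fbz] /andP[Fbu' Fbz'] nb nu nz pS qS.
have [_ _ com] := R.
have [y [yu yz]] := com u z' [:: b; b'] uU zZ' isT; rewrite !inE negb_or => /andP[yb yb'].
have [y' [yu' yz']] := com u' z [:: b; b'; y] uU' zZ isT.
rewrite !inE !negb_or => /and3P[yb1 yb1' yy].
have nuz := rich_neq R uU zZ; have nuz' := rich_neq R uU' zZ'.
have nuz1 := rich_neq R uU zZ'; have nuz1' := rich_neq R uU' zZ.
apply: (linked8 disjXY FXY FG (x1 := b) (y1 := u) (x2 := y) (y2 := z')
  (x3 := b') (y3 := u') (x4 := y') (y4 := z)) => //.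
- by rewrite /= !inE !negb_or nb ![b == _]eq_sym yb yb1 yb' ![_ == y']eq_sym yb1' yy.
- by rewrite /= !inE !negb_or nuz1 nu nuz eq_sym nuz' eq_sym nz nuz1'.
- by move: pS; rewrite !inE => /orP[] ->; rewrite ?orbT.
- by move: qS; rewrite !inE => /orP[] ->; rewrite ?orbT.
Qed.

Lemma forks_same_ends b u z b' p q : fork b u z -> fork b' u z ->
    b != b' -> u != z ->
    p \in [:: (b, u); (b, z)] -> q \in [:: (b', u); (b', z)] ->
  Flinked 8 p q.
Proof.
move=> /andP[Fbu Fbz] /andP[Fbu' Fbz'] nb nuz pS qS; apply: (@linkedW _ _ _ 4) => //.
apply: (linked4 disjXY FXY FG (x1 := b) (y1 := u) (x2 := b') (y2 := z)) => //.
- by rewrite /= inE nb.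
- by rewrite /= inE nuz.
- by move: pS; rewrite !inE => /orP[] ->; rewrite ?orbT.
- by move: qS; rewrite !inE => /orP[] ->; rewrite ?orbT.
Qed.

(* Two forks with a common end are closed up through [v], which is impossible
   when one of them is centred at [v]. *)
Lemma forks_apex U Z u z b' z' p q : rich U Z ->
    u \in U -> z \in Z -> z' \in Z -> fork b' u z' -> v != b' -> z != z' ->
    p \in [:: (v, u); (v, z)] -> q \in [:: (b', u); (b', z')] ->
  Flinked 8 p q.
Proof.
move=> R uU zZ zZ' /[dup] fk' /andP[Fbu' Fbz'] nb nz pS qS; have [_ Fv com] := R.
have [Fvu Fvz Fvz'] : [/\ F v u, F v z & F v z'].
  by split; apply: Fv; rewrite inE ?uU ?zZ ?zZ' ?orbT.
have nuz := rich_neq R uU zZ; have nuz' := rich_neq R uU zZ'.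
move: pS; rewrite !inE => /orP[/eqP-> | /eqP->].
  by apply: (forks_same_ends (b := v) _ fk' nb nuz' _ qS); [apply/andP | rewrite inE eqxx].
(* For [p = (v, z)], a further common neighbour [y] of [u] and [z] gives the 6-cycle
   [v z y u b' z']. *)
have [y [yu yz]] := com u z [:: v; b'] uU zZ isT; rewrite !inE negb_or => /andP[yv yb].
apply: (@linkedW _ _ _ 6) => //.
apply: (linked6 disjXY FXY FG (x1 := v) (y1 := z) (x2 := y) (y2 := u)
  (x3 := b') (y3 := z')) => //.
- by rewrite /= !inE !negb_or nb eq_sym yv yb.
- by rewrite /= !inE !negb_or nz eq_sym nuz nuz'.
- by rewrite inE eqxx.
- by move: qS; rewrite !inE => /orP[] ->; rewrite ?orbT.
Qed.

Lemma forks_common_end U Z u b z b' z' p q : rich U Z ->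
    u \in U -> z \in Z -> z' \in Z -> fork b u z -> fork b' u z' ->
    b != b' -> z != z' ->
    p \in [:: (b, u); (b, z)] -> q \in [:: (b', u); (b', z')] ->
  Flinked 8 p q.
Proof.
move=> R uU zZ zZ' fk fk' nb nz pS qS.
have [ebv|nbv] := eqVneq b v.
  by subst b; exact: (forks_apex R uU zZ zZ' fk' nb nz pS qS).
have [ebv'|nbv'] := eqVneq b' v.
  by subst b'; apply: linkedC; apply: (forks_apex R uU zZ' zZ fk _ _ qS pS);
     rewrite // eq_sym.
have nuz := rich_neq R uU zZ; have nuz' := rich_neq R uU zZ'.
have [_ Fv _] := R; have [/andP[Fbu Fbz] /andP[Fbu' Fbz']] := (fk, fk').
apply: (@linkedW _ _ _ 6) => //.
apply: (linked6 disjXY FXY FG (x1 := v) (y1 := z) (x2 := b) (y2 := u)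
  (x3 := b') (y3 := z')) => //.
- by apply: Fv; rewrite inE zZ orbT.
- by apply: Fv; rewrite inE zZ' orbT.
- by rewrite /= !inE !negb_or nb ![v == _]eq_sym nbv nbv'.
- by rewrite /= !inE !negb_or nz eq_sym nuz nuz'.
- by move: pS; rewrite !inE => /orP[] ->; rewrite ?orbT.
- by move: qS; rewrite !inE => /orP[] ->; rewrite ?orbT.
Qed.

Lemma linked_same_center U Z b u u' z : rich U Z ->
    u \in U -> z \in Z -> u' \in U -> F b u -> F b u' -> u != u' ->
  Flinked 8 (b, u) (b, u').
Proof.
move=> R uU zZ uU' Fbu Fbu' nu; have [_ _ com] := R.
have [y [yu yz]] := com u z [:: b] uU zZ isT; rewrite !inE => yb.
have [y' [yu' yz']] := com u' z [:: b; y] uU' zZ isT.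
rewrite !inE !negb_or => /andP[yb' yy].
have nuz := rich_neq R uU zZ; have nuz' := rich_neq R uU' zZ.
apply: (@linkedW _ _ _ 6) => //.
apply: (linked6 disjXY FXY FG (x1 := b) (y1 := u) (x2 := y) (y2 := z)
  (x3 := y') (y3 := u')) => //.
- by rewrite /= !inE !negb_or ![b == _]eq_sym yb yb' eq_sym yy.
- by rewrite /= !inE !negb_or nuz nu eq_sym nuz'.
- by rewrite inE eqxx.
- by rewrite !inE eqxx ?orbT.
Qed.

Lemma linked_fork U Z b u z : rich U Z -> u \in U -> z \in Z -> fork b u z ->
  Flinked 8 (b, u) (b, z).
Proof.
move=> R uU zZ /andP[Fbu Fbz]; have [_ _ com] := R.
have [y [yu yz]] := com u z [:: b] uU zZ isT; rewrite !inE => yb.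
apply: (@linkedW _ _ _ 4) => //.
apply: (linked4 disjXY FXY FG (x1 := b) (y1 := u) (x2 := y) (y2 := z)) => //.
- by rewrite /= inE eq_sym yb.
- by rewrite /= inE (rich_neq R uU zZ).
- by rewrite inE eqxx.
- by rewrite !inE eqxx ?orbT.
Qed.

(** Each edge is put into a fork, and the coincidences between the two forks select the cycle.
    Exchanging [U] and [Z] by [richC] covers the symmetric cases. *)
Lemma rich_connected U Z : rich U Z ->
    (forall x y, F x y -> exists u z, [/\ u \in U, z \in Z, fork x u z & y \in [:: u; z]]) ->
  internally_cycle_connected 8 (spanned G F).
Proof.
move=> R forkF; apply: spanned_connected => -[b w] [b' w'] /= Fbw Fbw' neq.
have [u [z [uU zZ fk wS]]] := forkF _ _ Fbw.
have [u' [z' [uU' zZ' fk' wS']]] := forkF _ _ Fbw'.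
have [eb|nb] := eqVneq b b'.
  subst b'; have {neq} nw : w != w' by apply: contraNneq neq => ->.
  have [/andP[Fbu Fbz] /andP[Fbu' Fbz']] := (fk, fk').
  move: nw wS wS'; rewrite !inE => nw /orP[] /eqP ew /orP[] /eqP ew'; subst w w'.
  - exact: (linked_same_center R uU zZ uU').
  - by apply: (linked_fork R) => //; apply/andP.
  - by apply: linkedC; apply: (linked_fork R) => //; apply/andP.
  - exact: (linked_same_center (richC R) zZ uU zZ').
have pS : (b, w) \in [:: (b, u); (b, z)].
  by move: wS; rewrite !inE => /orP[] /eqP->; rewrite eqxx ?orbT.
have qS : (b', w') \in [:: (b', u'); (b', z')].
  by move: wS'; rewrite !inE => /orP[] /eqP->; rewrite eqxx ?orbT.
have [eu|nu] := eqVneq u u'; have [ez|nz] := eqVneq z z'.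
- subst u' z'; apply: (forks_same_ends fk fk' nb _ pS qS).
  exact: rich_neq R uU zZ.
- by subst u'; exact: (forks_common_end R uU zZ zZ' fk fk' nb nz pS qS).
- subst z'; apply: (forks_common_end (richC R) zZ uU uU' _ _ nb nu).
  + by rewrite /fork andbC.
  + by rewrite /fork andbC.
  + by move: pS; rewrite !inE orbC.
  + by move: qS; rewrite !inE orbC.
- exact: (forks_distinct R uU zZ uU' zZ' fk fk' nb nu nz pS qS).
Qed.

End EightCycles.

Definition codeg x z : nat := #|[set b | E b x && E b z]|.

Lemma codegC x z : codeg x z = codeg z x.
Proof. by apply: eq_card => b; rewrite !inE andbC. Qed.

Section CommonNeighbours.
Variables (v : T) (U Z : {set T}).

Definition between x y :=
  [&& E x y, y \in U :|: Z, [exists u in U, E x u] & [exists z in Z, E x z]].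

(** A common neighbour of [u] and [z] in [E] is itself adjacent to both sets, so none is lost in
    passing from [E] to [between]. *)
Lemma between_fork b u z : u \in U -> z \in Z -> E b u -> E b z ->
  fork between b u z.
Proof.
move=> uU zZ bu bz; rewrite /fork /between !inE uU zZ bu bz !orbT /=.
by rewrite andbb; apply/andP; split; apply/existsP; [exists u | exists z]; apply/andP.
Qed.

Lemma between_connected :
    [disjoint U & Z] -> (forall w, w \in U :|: Z -> E v w) ->
    (forall u z, u \in U -> z \in Z -> 4 <= codeg u z)%N ->
  internally_cycle_connected 8 (spanned G between).
Proof.
move=> disj Ev cod.
have forkP x y : between x y ->
    exists u z, [/\ u \in U, z \in Z, fork between x u z & y \in [:: u; z]].
  case/and4P => Exy; rewrite inE => yUZ /existsP[u /andP[uU Exu]] /existsP[z /andP[zZ Exz]].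
  case/orP: yUZ => [yU|yZ].
    by exists y, z; split; rewrite ?inE ?eqxx //; apply: between_fork.
  by exists u, y; split; rewrite ?inE ?eqxx ?orbT //; apply: between_fork.
(* If [U] or [Z] is empty there are no edges; otherwise [u0] and [z0] witness that the edges at [v]
   belong to [between]. *)
have [U0|[u0 uU0]] := set_0Vmem U.
  apply: spanned_connected => p q /forkP[u [z []]]; by rewrite U0 inE.
have [Z0|[z0 zZ0]] := set_0Vmem Z.
  apply: spanned_connected => p q /forkP[u [z []]]; by rewrite Z0 inE.
apply: (@rich_connected between v _ _ U Z) => //.
- by move=> x y /and4P[/EXY].
- by move=> x y /and4P[/EG].
split=> // [w wUZ|u z s uU zZ s3].
  rewrite /between Ev // wUZ /=; apply/andP; split; apply/existsP.
    by exists u0; rewrite uU0 Ev // inE uU0.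
  by exists z0; rewrite zZ0 Ev // inE zZ0 orbT.
have [bS|] := boolP ([set b | E b u && E b z] \subset s).
  have := leq_trans (cod u z uU zZ) (leq_trans (subset_leq_card bS) (card_size s)).
  by move/leq_trans/(_ s3).
case/subsetPn => b; rewrite inE => /andP[bu bz] bs; exists b.
by have /andP[? ?] := between_fork uU zZ bu bz.
Qed.

Lemma between_size :
  num_edges (spanned G between) = (\sum_x \sum_y between x y)%N.
Proof.
apply: (num_edges_spanned disjXY).
- by move=> x y /and4P[/EXY].
- by move=> x y /and4P[/EG].
Qed.

End CommonNeighbours.
End ConnectedStructures.

(** * Extremal choices *)

Section MaxCut.
Variables (T : finType) (e : rel T).
Hypotheses (esym : symmetric e) (eirr : irreflexive e).

Definition cut (X : {set T}) : nat := \sum_(x in X) \sum_(y in ~: X) e x y.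

Lemma cutC X : cut (~: X) = cut X.
Proof.
rewrite /cut setCK exchange_big; apply: eq_bigr => y _.
by apply: eq_bigr => x _; rewrite esym.
Qed.

(** Moving [v] to the other side cannot enlarge the cut, so [v] has at most as many neighbours
    inside [X] as outside. *)
Lemma max_cut_inside X : (forall X', cut X' <= cut X)%N ->
  (\sum_(v in X) \sum_(x in X) e v x <= cut X)%N.
Proof.
move=> Xmax; apply: leq_sum => v vX; have := Xmax (X :\ v).
rewrite /cut (big_setD1 v vX) /=.
rewrite (big_setD1 v vX) eirr /= add0n.
under eq_bigr => x _.
  rewrite (_ : \sum_(y in ~: (X :\ v)) e x y = e v x + \sum_(y in ~: X) e x y)%N; last first.
    rewrite (_ : ~: (X :\ v) = v |: ~: X); last by rewrite setCD setUC.
    by rewrite big_setU1 ?inE ?vX // esym.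
  over.
by rewrite big_split /= leq_add2r.
Qed.

(** Ordered pairs are counted: each of the two parts contains at most [cut X] of them, and there are
    [cut X] crossing pairs in each direction. *)
Lemma max_cut : exists X : {set T},
  (\sum_x \sum_y e x y <= 4 * \sum_(x in X) \sum_(y in ~: X) e x y)%N.
Proof.
pose X := [arg max_(X > set0 : {set T}) cut X]; exists X; rewrite -/(cut X).
have Xmax X' : (cut X' <= cut X)%N.
  by rewrite /X; case: arg_maxnP => // X1 _; apply.
have in1 := max_cut_inside Xmax.
have in2 : (\sum_(v in ~: X) \sum_(x in ~: X) e v x <= cut X)%N.
  by rewrite -(cutC X); apply: max_cut_inside => X'; rewrite cutC.
have splitX (g : T -> nat) : (\sum_x g x = \sum_(x in X) g x + \sum_(x in ~: X) g x)%N.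
  rewrite (bigID (mem X)) /=; congr (_ + _)%N.
  by apply: eq_bigl => x; rewrite inE.
rewrite splitX; under eq_bigr do rewrite splitX.
under [X in (_ + X <= _)%N]eq_bigr do rewrite splitX.
rewrite !big_split /= -/(cut X).
have : (\sum_(i in ~: X) \sum_(x in X) e i x)%N = cut X.
  by rewrite -cutC /cut setCK.
move: in1 in2; lia.
Qed.

End MaxCut.

(** * Subgraphs of large minimum degree *)

Section MinDegree.
Variables (R : realFieldType) (T : finType) (E : rel T).

(** The pair maximises edges minus [D] times vertices: deleting a vertex of degree below [D] would
    increase this quantity. *)
Lemma min_degree (X0 Y0 : {set T}) (D : R) :
  exists X Y : {set T},
  [/\ forall x, x \in X -> D <= \sum_(y in Y) (E x y)%:R,
      forall y, y \in Y -> D <= \sum_(x in X) (E x y)%:R &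
      \sum_(x in X0) \sum_(y in Y0) (E x y)%:R - D * (#|X0| + #|Y0|)%:R <=
      \sum_(x in X) \sum_(y in Y) (E x y)%:R - D * (#|X| + #|Y|)%:R].
Proof.
pose Phi (p : {set T} * {set T}) : R :=
  \sum_(x in p.1) \sum_(y in p.2) (E x y)%:R - D * (#|p.1| + #|p.2|)%:R.
case: (@arg_maxP _ _ _ (X0, Y0) xpredT Phi) => // -[X Y] _ XYmax.
exists X, Y; split=> [x xX|y yY|]; last by apply: (XYmax (X0, Y0)).
- have : Phi (X :\ x, Y) <= Phi (X, Y) := XYmax (X :\ x, Y) isT.
  rewrite /Phi /= (big_setD1 x xX) /= (cardsD1 x X) xX !natrD /= => h; lra.
- have : Phi (X, Y :\ y) <= Phi (X, Y) := XYmax (X, Y :\ y) isT; rewrite /Phi /=.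
  under [in X in _ <= X -> _]eq_bigr do rewrite (big_setD1 y yY) /=.
  rewrite big_split /= (cardsD1 y Y) yY !natrD /= => h; lra.
Qed.

End MinDegree.

(** * Choice of a covering set that kills few pairs *)

Section GreedyCover.
Variables (R : realFieldType) (T : finType) (A : {set T}) (K E fn : rel T).
Variables (Q s tau : R).
Hypotheses (s_gt0 : 0 < s) (tau_gt0 : 0 < tau) (Qs : Q <= tau * s).
Hypothesis fnQ : forall x b, fn x b -> \sum_(u in A) (K x u)%:R <= Q.
Hypothesis fns : forall x b, fn x b -> s <= \sum_(u in A) (E b u && ~~ K x u)%:R.

Definition killed (U : {set T}) x := [exists u in U, K x u].
Definition covered (U : {set T}) b := [exists u in U, E b u].

Lemma killedU1 U u x : killed (u |: U) x = K x u || killed U x.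
Proof.
apply/existsP/idP => [[w /andP[]]|].
  rewrite !inE => /orP[/eqP->->//|wU Kw]; apply/orP; right.
  by apply/existsP; exists w; rewrite wU.
case/orP => [Kxu|/existsP[w /andP[wU Kw]]]; first by exists u; rewrite setU11.
by exists w; rewrite inE wU orbT.
Qed.

Lemma coveredU1 U u b : covered (u |: U) b = E b u || covered U b.
Proof.
apply/existsP/idP => [[w /andP[]]|].
  rewrite !inE => /orP[/eqP->->//|wU Kw]; apply/orP; right.
  by apply/existsP; exists w; rewrite wU.
case/orP => [Kxu|/existsP[w /andP[wU Kw]]]; first by exists u; rewrite setU11.
by exists w; rewrite inE wU orbT.
Qed.

(* [U] maximises [f U - lam * g U], where [f U] counts the pairs that are covered
   and survive, and [g U] those that are killed; the claim comes from averaging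
   over [u \in A] the effect of adding [u] to [U]. *)
Lemma greedy_cover : exists2 U : {set T}, U \subset A &
  \sum_x \sum_b (fn x b)%:R <=
  2 * (1 + 3 * tau) * \sum_x \sum_b ([&& fn x b, ~~ killed U x & covered U b])%:R.
Proof.
pose f U : R := \sum_x \sum_b ([&& fn x b, ~~ killed U x & covered U b])%:R.
pose g U : R := \sum_x \sum_b (fn x b && killed U x)%:R.
pose r U : R := \sum_x \sum_b ([&& fn x b, ~~ killed U x & ~~ covered U b])%:R.
pose P : R := \sum_x \sum_b (fn x b)%:R.
have PE U : P = f U + g U + r U.
  rewrite /P /f /g /r -!big_split /=; apply: eq_bigr => x _.
  rewrite -!big_split /=; apply: eq_bigr => b _.
  by case: (fn x b) (killed U x) (covered U b) => [] [] []; rewrite /= ?addr0 ?add0r.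
have f0 U : 0 <= f U by do 2 apply: sumr_ge0 => ? _; apply: ler0n.
have g0 U : 0 <= g U by do 2 apply: sumr_ge0 => ? _; apply: ler0n.
have r0 U : 0 <= r U by do 2 apply: sumr_ge0 => ? _; apply: ler0n.
(* This makes [tau * lam] one half, so that the term in [P] in the bound on [r U] can be
   absorbed. *)
have [lam lam0 lamE] : exists2 lam, 0 < lam & 2 * tau * lam = 1.
  by exists (2 * tau)^-1; rewrite ?invr_gt0 ?mulfV ?mulf_neq0 ?mulr_gt0 ?gt_eqF.
pose Phi U := f U - lam * g U.
have := @arg_maxP _ _ _ (set0 : {set T}) (fun U : {set T} => U \subset A) Phi (sub0set A).
case=> U UA Umax; exists U => //; rewrite -/P -/(f U).
(* Comparison with the empty selection, which kills nothing. *)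
have Phi0 : lam * g U <= f U.
  have : Phi set0 <= Phi U := Umax set0 (sub0set A).
  rewrite /Phi.
  have -> : g set0 = 0.
    apply: big1 => x _; apply: big1 => b _; rewrite (_ : killed set0 x = false) ?andbF //.
    by apply/existsP => -[u]; rewrite inE.
  by move: (f0 set0); lra.
(* Summing over [u]: a pair neither killed nor covered has at least [s] vertices that would cover
   without killing it, while any fine pair has at most [Q] killers. *)
have main : s * r U <= Q * f U + lam * (Q * P).
  (* By optimality, what [u] would newly cover is at most what it would kill among the covered
     pairs, plus [lam] times all that it would kill. *)
  have step u : u \in A ->
      \sum_x \sum_b ([&& fn x b, ~~ killed U x & ~~ covered U b] && (E b u && ~~ K x u))%:R
      <= \sum_x \sum_b ([&& fn x b, ~~ killed U x & covered U b] && K x u)%:R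
       + lam * \sum_x \sum_b (fn x b && K x u)%:R :> R.
    move=> uA; have : Phi (u |: U) <= Phi U by apply: Umax; rewrite subUset sub1set uA.
    rewrite /Phi.
    have : g (u |: U) <= g U + \sum_x \sum_b (fn x b && K x u)%:R.
      rewrite -big_split; apply: ler_sum => x _; rewrite -big_split; apply: ler_sum => b _ /=.
      rewrite killedU1 -natrD ler_nat.
      by case: (fn x b) (killed U x) (K x u) => [] [] [].
    have : f U + \sum_x \sum_b
          ([&& fn x b, ~~ killed U x & ~~ covered U b] && (E b u && ~~ K x u))%:R
        <= f (u |: U) + \sum_x \sum_b ([&& fn x b, ~~ killed U x & covered U b] && K x u)%:R.
      rewrite -!big_split; apply: ler_sum => x _; rewrite -!big_split; apply: ler_sum => b _ /=.
      rewrite killedU1 coveredU1 -!natrD ler_nat.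
      by case: (fn x b) (killed U x) (K x u) (covered U b) (E b u) => [] [] [] [] [].
    move=> h1 h2 h3; have := ler_wpM2l (ltW lam0) h2; lra.
  have tot : \sum_(u in A) \sum_x \sum_b
        ([&& fn x b, ~~ killed U x & ~~ covered U b] && (E b u && ~~ K x u))%:R
      <= \sum_(u in A) (\sum_x \sum_b ([&& fn x b, ~~ killed U x & covered U b] && K x u)%:R
       + lam * \sum_x \sum_b (fn x b && K x u)%:R) :> R.
    by apply: ler_sum => u; apply: step.
  rewrite big_split -mulr_sumr /= in tot.
  apply: le_trans (le_trans _ tot) _.
    rewrite exchange_big mulr_sumr; apply: ler_sum => x _ /=.
    rewrite exchange_big mulr_sumr; apply: ler_sum => b _ /=.
    case: (boolP [&& _, _ & _]) => [/andP[fnxb _]|_]; last first.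
      by rewrite mulr0; apply: sumr_ge0 => ? _; apply: ler0n.
    by rewrite mulr1; apply: fns fnxb.
  have sumK (c : T -> T -> bool) : (forall x b, c x b -> fn x b) ->
      \sum_(u in A) \sum_x \sum_b (c x b && K x u)%:R <= Q * \sum_x \sum_b (c x b)%:R.
    move=> cfn; rewrite exchange_big mulr_sumr; apply: ler_sum => x _ /=.
    rewrite exchange_big mulr_sumr; apply: ler_sum => b _ /=.
    have [cxb|_] := boolP (c x b); last by rewrite mulr0 big1.
    by rewrite mulr1; apply: (fnQ (cfn _ _ cxb)).
  apply: lerD; first by apply: sumK => x b /andP[].
  by rewrite ler_pM2l //; apply: sumK.
have gle : g U <= 2 * tau * f U.
  have gE : g U = 2 * tau * lam * g U by rewrite lamE mul1r.
  by have := ler_wpM2l (ltW tau_gt0) Phi0; lra.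
have rle : r U <= tau * f U + tau * lam * P.
  have P0 : 0 <= P by rewrite (PE U) !addr_ge0.
  have : Q * (f U + lam * P) <= tau * s * (f U + lam * P).
    by apply: ler_wpM2r => //; apply: addr_ge0 => //; apply: mulr_ge0 => //; apply: ltW.
  by move=> le_tau; rewrite -(ler_pM2l s_gt0); move: main le_tau; lra.
have half : tau * lam = 2^-1 by move: lamE; lra.
(* In total [P <= f U + 2 * tau * f U + (tau * f U + P / 2)]. *)
rewrite half in rle; have := PE U; lra.
Qed.

End GreedyCover.

(** * Double counting *)

Section Selection.
Variables (R : realFieldType) (T : finType) (E : rel T) (X Y : {set T}) (n d : R).
Hypothesis EXY : forall x y, E x y -> (x \in X) && (y \in Y).

Let e : R := \sum_x \sum_y (E x y)%:R.
Let dX x : R := \sum_y (E x y)%:R.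
Let dY y : R := \sum_x (E x y)%:R.

Hypotheses (n_gt0 : 0 < n) (d_gt0 : 0 < d).
Hypothesis degX : forall x, x \in X -> d <= dX x.
Hypothesis degY : forall y, y \in Y -> d <= dY y.
Hypothesis cardXY : (#|X| + #|Y|)%:R <= n.
Hypothesis e_ge : n * d <= e.

Lemma dX_out x : x \notin X -> dX x = 0.
Proof.
by move=> xX; apply: big1 => y _; case: (boolP (E x y)) => // /EXY/andP[]; rewrite (negPf xX).
Qed.

Lemma dY_out y : y \notin Y -> dY y = 0.
Proof.
by move=> yY; apply: big1 => x _; case: (boolP (E x y)) => // /EXY/andP[]; rewrite (negPf yY).
Qed.

Lemma sum_dY : \sum_y dY y = e.
Proof. exact: exchange_big. Qed.

Lemma sum_ind (A : {set T}) : \sum_x (x \in A)%:R = #|A|%:R :> R.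
Proof.
rewrite -sum1_card natr_sum [RHS]big_mkcond; apply: eq_bigr => x _.
by case: (x \in A).
Qed.

Lemma cardX_le : #|X|%:R <= n.
Proof. by apply: le_trans cardXY; rewrite ler_nat leq_addr. Qed.

Lemma cardY_le : #|Y|%:R <= n.
Proof. by apply: le_trans cardXY; rewrite ler_nat leq_addl. Qed.

(** Degenerate walks, with [b = v] or [a = u], are included. *)
Definition walks v u : R := \sum_b \sum_a (E v a)%:R * (E b a)%:R * (E b u)%:R.

(** An edge [b a] is the middle of [dY a * dX b] walks. *)
Lemma sum_walks : d ^+ 2 * e <= \sum_v \sum_u walks v u.
Proof.
have -> : \sum_v \sum_u walks v u = \sum_b \sum_a (E b a)%:R * dY a * dX b.
  under eq_bigr do (rewrite exchange_big /=; under eq_bigr do rewrite exchange_big /=).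
  rewrite exchange_big; apply: eq_bigr => b _ /=.
  rewrite exchange_big; apply: eq_bigr => a _ /=.
  rewrite mulrAC mulr_sumr; apply: eq_bigr => v _.
  by rewrite -mulr_sumr -/(dX b); ring.
rewrite mulr_sumr; apply: ler_sum => b _; rewrite mulr_sumr; apply: ler_sum => a _.
have [/EXY/andP[bX aY]|_] := boolP (E b a); last by rewrite mulr0 !mul0r.
rewrite mulr1 mul1r expr2; by apply: ler_pM; [exact: ltW|exact: ltW|exact: degY|exact: degX].
Qed.

(** Averaging over [X] and [Y]: the required values sum to at most three quarters of [d ^+ 2 * e].
    The degree terms reserve room for degenerate walks and for middle edges meeting a given one. *)
Lemma rich_pair : 16 * n <= d ^+ 2 ->
  exists v u, d ^+ 3 / (2 * n) + 4 * (dX v + dY u) <= walks v u.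
Proof.
move=> large; set c := d ^+ 3 / (2 * n).
have c0 : 0 <= c by rewrite divr_ge0 ?exprn_ge0 ?mulr_ge0 ?ltW.
have [/existsP[v /existsP[u ?]]|no] :=
  boolP [exists v, [exists u, c + 4 * (dX v + dY u) <= walks v u]]; first by exists v, u.
exfalso.
(* Both sides vanish when [v] is outside [X] or [u] outside [Y], so the bound can be summed over all
   of [T]. *)
have le_walks v u : walks v u <= (v \in X)%:R * (u \in Y)%:R * c +
    4 * (u \in Y)%:R * dX v + 4 * (v \in X)%:R * dY u.
  have [vX|vX] := boolP (v \in X); last first.
    rewrite mul0r mulr0 !mul0r dX_out // mulr0 !addr0 /walks big1 // => b _; apply: big1 => a _.
    by case: (boolP (E v a)) => [/EXY/andP[]|]; rewrite ?(negPf vX) ?mul0r.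
  have [uY|uY] := boolP (u \in Y); last first.
    rewrite !(mulr0, mul0r) dY_out // !(mulr0, addr0) /walks big1 // => b _; apply: big1 => a _.
    by case: (boolP (E b u)) => [/EXY/andP[]|]; rewrite ?(negPf uY) ?mulr0.
  have : walks v u < c + 4 * (dX v + dY u).
    by rewrite ltNge; apply: contra no => ?; apply/existsP; exists v; apply/existsP; exists u.
  by rewrite !(mulr1, mul1r) => /ltW; lra.
have : \sum_v \sum_u walks v u <= #|X|%:R * #|Y|%:R * c + 4 * #|Y|%:R * e + 4 * #|X|%:R * e.
  pose bnd v u := (v \in X)%:R * (u \in Y)%:R * c +
    4 * (u \in Y)%:R * dX v + 4 * (v \in X)%:R * dY u.
  have le_bnd : \sum_v \sum_u walks v u <= \sum_v \sum_u bnd v u.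
    by apply: ler_sum => v _; apply: ler_sum => u _; apply: le_walks.
  apply: le_trans le_bnd _; rewrite /bnd.
  have inner v : \sum_u bnd v u =
      (v \in X)%:R * (#|Y|%:R * c) + 4 * #|Y|%:R * dX v + (v \in X)%:R * (4 * e).
    rewrite !big_split /= -!mulr_suml -!mulr_sumr sum_ind sum_dY; ring.
  rewrite (eq_bigr _ (fun v _ => inner v)) !big_split /= -!mulr_suml -mulr_sumr sum_ind -/e.
  lra.
have := sum_walks.
have XY := cardXY; rewrite natrD in XY.
have [X0 Y0] : (0 <= #|X|%:R :> R) * (0 <= #|Y|%:R :> R) by split; apply: ler0n.
have nd0 : 0 < n * d by apply: mulr_gt0.
have e0 : 0 < e by apply: lt_le_trans e_ge.
have h1 : #|X|%:R * #|Y|%:R * c <= n * d ^+ 3 / 2.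
  have -> : n * d ^+ 3 / 2 = n * n * c by rewrite /c; field; rewrite gt_eqF.
  by apply: ler_wpM2r => //; apply: ler_pM => //; rewrite ?cardX_le ?cardY_le.
have h2 : 4 * #|Y|%:R * e + 4 * #|X|%:R * e <= 4 * n * e.
  have := ler_wpM2r (ltW e0) XY; lra.
have h3 : 4 * n * e <= d ^+ 2 / 4 * e by apply: ler_wpM2r; [exact: ltW | lra].
have h4 : d ^+ 2 * (n * d) <= d ^+ 2 * e by apply: ler_wpM2l => //; apply: exprn_ge0; apply: ltW.
have h5 : 0 < n * d ^+ 3 by rewrite mulr_gt0 ?exprn_gt0.
have h6 : d ^+ 2 * (n * d) = n * d ^+ 3 by ring.
move=> h7 h8; lra.
Qed.

(* Closeness includes equality, so that no vertex survives its own selection. *)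
Definition close x z := (x == z) || (codeg E x z < 4)%N.

(** The two bounds are what [greedy_cover] asks, with the neighbourhood of [v] as [A] and [close] as
    [K]: few vertices kill [x], and many others cover [b]. *)
Definition fine (Q s : R) v x b :=
  [&& E v x, E b x, \sum_z (E v z && close x z)%:R <= Q &
      s <= \sum_z [&& E v z, E b z & ~~ close x z]%:R].

Let pathw v b x : R := (E v x)%:R * (E b x)%:R.
Let near v x : R := \sum_z (E v z && close x z)%:R.
Let near2 v b x : R := \sum_z (E v z)%:R * (E b z)%:R * (close x z)%:R.
Let codegr x z : R := \sum_b (E b x)%:R * (E b z)%:R.

Lemma codegrE x z : codegr x z = (codeg E x z)%:R.
Proof.
rewrite /codeg -sum1_card natr_sum [RHS]big_mkcond; apply: eq_bigr => b _.
by rewrite inE -natrM mulnb; case: (_ && _).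
Qed.

Lemma codegr_diag x : codegr x x = dY x.
Proof. by apply: eq_bigr => b _; case: (E b x); rewrite ?mulr1 ?mulr0. Qed.

(** A close [z] other than [x] has at most 3 common neighbours with [x]; the diagonal contributes
    the degree. The exponents 1 and 2 serve the two counts below. *)
Lemma close_codegr k x z : x \in Y -> (k <= 1)%N ->
  (close x z)%:R * codegr x z ^+ k.+1 <= (x == z)%:R * dY x ^+ k.+1 + 3 ^+ k.+1 * (z \in Y)%:R.
Proof.
move=> xY k1; rewrite /close.
have dY0 : 0 <= dY x by apply: sumr_ge0 => ? _; apply: ler0n.
have [<-|nxz] := eqVneq x z; first by rewrite codegr_diag /= lerDl mulr_ge0 ?exprn_ge0.
rewrite mul0r add0r /=; case: ltnP => c4; last by rewrite mul0r mulr_ge0 ?exprn_ge0.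
rewrite mul1r; have [zY|zY] := boolP (z \in Y); last first.
  rewrite mulr0 /codegr big1 ?expr0n ?lexx // => b _.
  by case: (boolP (E b z)) => [/EXY/andP[]|]; rewrite ?(negPf zY) ?mulr0.
rewrite mulr1 codegrE -natrX -natrX ler_nat leq_exp2r //.
Qed.

(** A path that is not fine has [near] above [Q], or [v] and [b] have fewer than [2 * s] common
    neighbours, or more than [s] of these are close to [x]; the corresponding term is then at least
    1. *)
Lemma nonfine_le (Q s : R) v b x : 0 < Q -> 0 < s ->
  pathw v b x <= (fine Q s v x b)%:R + pathw v b x * near v x / Q
    + (\sum_z pathw v b z < 2 * s)%R%:R * pathw v b x + pathw v b x * near2 v b x / s.
Proof.
move=> Q0 s0.
have near0 : 0 <= near v x by apply: sumr_ge0 => ? _; apply: ler0n.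
have near20 : 0 <= near2 v b x by apply: sumr_ge0 => ? _; rewrite !mulr_ge0.
rewrite /pathw /fine; case: (E v x); case: (E b x); rewrite ?(mul0r, mulr0, addr0) //=.
rewrite !(mulr1, mul1r).
have t1 : 0 <= near v x / Q by apply: divr_ge0 => //; apply: ltW.
have t2 : 0 <= near2 v b x / s by apply: divr_ge0 => //; apply: ltW.
case: (lerP _ Q) => /= hQ; last first.
  have : 1 <= near v x / Q by rewrite ler_pdivlMr // mul1r ltW.
  have := ler0n R ((\sum_z (E v z)%:R * (E b z)%:R < 2 * s)%R); lra.
case: (lerP s _) => /= hs.
  have := ler0n R ((\sum_z (E v z)%:R * (E b z)%:R < 2 * s)%R); lra.
case: (ltP (\sum_z _) (2 * s)) => /= h2; first lra.
have : 1 <= near2 v b x / s; last by lra.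
rewrite ler_pdivlMr // mul1r.
have : \sum_z (E v z)%:R * (E b z)%:R =
   \sum_z [&& E v z, E b z & ~~ close x z]%:R + near2 v b x.
  rewrite -big_split; apply: eq_bigr => z _ /=.
  by case: (E v z) (E b z) (close x z) => [] [] []; rewrite /= ?(mulr0, mulr1, addr0, add0r).
lra.
Qed.

Lemma sum3_rot (g : T -> T -> T -> R) :
  \sum_v \sum_b \sum_x g v b x = \sum_x \sum_v \sum_b g v b x.
Proof. by rewrite [RHS]exchange_big; apply: eq_bigr => v _; apply: exchange_big. Qed.

Let dY2 : R := \sum_x dY x ^+ 2.

Lemma sum_pathw : \sum_v \sum_b \sum_x pathw v b x = dY2.
Proof.
rewrite sum3_rot; apply: eq_bigr => x _; rewrite expr2 [RHS]mulr_suml.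
by apply: eq_bigr => v _; rewrite mulr_sumr.
Qed.

(** For fixed [x], the vertex [b] is free and contributes [dY x], while [v] runs over the common
    neighbours of [x] and the close vertex [z]. *)
Lemma sum_near_le : \sum_v \sum_b \sum_x pathw v b x * near v x <= dY2 + 3 * n * e.
Proof.
rewrite sum3_rot -sum_dY mulr_sumr -big_split; apply: ler_sum => x _ /=.
have -> : \sum_v \sum_b pathw v b x * near v x =
    dY x * \sum_z (close x z)%:R * codegr x z.
  under [in RHS]eq_bigr do rewrite mulr_sumr.
  rewrite [X in _ * X]exchange_big mulr_sumr; apply: eq_bigr => v _ /=.
  rewrite -mulr_suml /pathw -mulr_sumr -/(dY x) mulrAC mulrC; congr (_ * _).
  rewrite mulr_sumr; apply: eq_bigr => z _.
  by rewrite -mulnb natrM; ring.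
have [xY|xY] := boolP (x \in Y); last by rewrite dY_out // mul0r mulr0 expr0n addr0.
have dY0 : 0 <= dY x by apply: le_trans (degY xY); apply: ltW.
rewrite expr2 [3 * n * _]mulrC -mulrDr ler_wpM2l //.
have le1 : \sum_z (close x z)%:R * codegr x z <=
    \sum_z ((x == z)%:R * dY x + 3 * (z \in Y)%:R).
  by apply: ler_sum => z _; apply: (close_codegr (k := 0)).
apply: le_trans le1 _; rewrite big_split /= -mulr_suml -mulr_sumr sum_ind.
apply: lerD; last by rewrite ler_wpM2l // cardY_le.
by rewrite (bigD1 x) //= eqxx big1 ?addr0 ?mul1r // => z; rewrite eq_sym => /negPf->.
Qed.

(** Here [v] and [b] are both common neighbours of [x] and [z], which squares the codegree. *)
Lemma sum_near2_le : \sum_v \sum_b \sum_x pathw v b x * near2 v b x <= dY2 + 9 * n ^+ 2.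
Proof.
have le_x x : \sum_v \sum_b pathw v b x * near2 v b x <= dY x ^+ 2 + 9 * n * (x \in Y)%:R.
  have -> : \sum_v \sum_b pathw v b x * near2 v b x =
      \sum_z (close x z)%:R * codegr x z ^+ 2.
    rewrite [RHS](eq_bigr (fun z => \sum_v \sum_b
       pathw v b x * ((E v z)%:R * (E b z)%:R * (close x z)%:R))); last first.
      move=> z _; rewrite expr2 mulrA {1}/codegr mulr_sumr mulr_suml.
      apply: eq_bigr => v _; rewrite mulr_sumr; apply: eq_bigr => b _.
      by rewrite /pathw; ring.
    rewrite -sum3_rot; apply: eq_bigr => v _; apply: eq_bigr => b _.
    by rewrite mulr_sumr.
  have [xY|xY] := boolP (x \in Y); last first.
    rewrite dY_out // mulr0 expr0n addr0 big1 // => z _.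
    rewrite /codegr big1 ?expr0n ?mulr0 // => b _.
    by case: (boolP (E b x)) => [/EXY/andP[]|]; rewrite ?(negPf xY) ?mul0r.
  have le1 : \sum_z (close x z)%:R * codegr x z ^+ 2 <=
      \sum_z ((x == z)%:R * dY x ^+ 2 + 3 ^+ 2 * (z \in Y)%:R).
    by apply: ler_sum => z _; apply: (close_codegr (k := 1)).
  apply: le_trans le1 _; rewrite big_split /= -mulr_suml -mulr_sumr sum_ind.
  apply: lerD; last first.
    rewrite mulr1 (_ : 3 ^+ 2 = 9); last by rewrite -natrX.
    by rewrite ler_wpM2l // cardY_le.
  by rewrite (bigD1 x) //= eqxx big1 ?addr0 ?mul1r // => z; rewrite eq_sym => /negPf->.
rewrite sum3_rot; apply: le_trans (_ : \sum_x (dY x ^+ 2 + 9 * n * (x \in Y)%:R) <= _).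
  by apply: ler_sum => x _; apply: le_x.
rewrite big_split /= -mulr_sumr sum_ind lerD2l expr2 mulrA.
by rewrite ler_wpM2l ?cardY_le // mulr_ge0 // ltW.
Qed.

Lemma sum_few_le s : 0 < s ->
  \sum_v \sum_b \sum_x (\sum_z pathw v b z < 2 * s)%R%:R * pathw v b x <= 2 * s * n ^+ 2.
Proof.
move=> s0; pose bnd v b := (v \in X)%:R * ((b \in X)%:R * (2 * s)).
apply: le_trans (_ : \sum_v \sum_b bnd v b <= _); last first.
  rewrite /bnd; under eq_bigr do rewrite -mulr_sumr -mulr_suml sum_ind.
  rewrite -mulr_suml sum_ind (_ : 2 * s * n ^+ 2 = n * (n * (2 * s))); last by ring.
  have s2 : 0 <= 2 * s by rewrite mulr_ge0 ?ltW.
  apply: ler_pM; [exact: ler0n | by apply: mulr_ge0 | exact: cardX_le |].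
  by apply: ler_wpM2r s2 _ _ _; apply: cardX_le.
apply: ler_sum => v _; apply: ler_sum => b _; rewrite -mulr_sumr /bnd.
have [vX|vX] := boolP (v \in X); last first.
  rewrite mul0r big1 ?mulr0 // => x _; rewrite /pathw.
  by case: (boolP (E v x)) => [/EXY/andP[]|]; rewrite ?(negPf vX) ?mul0r.
have [bX|bX] := boolP (b \in X); last first.
  rewrite mul0r mulr0 big1 ?mulr0 // => x _; rewrite /pathw.
  by case: (boolP (E b x)) => [/EXY/andP[]|]; rewrite ?(negPf bX) ?mulr0.
rewrite !mul1r; case: ltP => [/ltW|_]; rewrite ?mul1r // mul0r.
by rewrite mulr_ge0 ?ltW.
Qed.

(** Otherwise the fine paths number at most [n * d ^+ 2 / 2], which is at most half of [dY2], and
    the three error terms add up to less than a quarter of [dY2]. *)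
Lemma fine_apex : 512 * n <= d ^+ 2 -> d <= n ->
  exists2 v, v \in X &
    d ^+ 2 / 2 <= \sum_x \sum_b (fine (48 * n / d) (d ^+ 2 / (32 * n)) v x b)%:R.
Proof.
move=> large dn; set Q := 48 * n / d; set s := d ^+ 2 / (32 * n).
have Q48 : 48 <= Q by rewrite /Q ler_pdivlMr // ler_wpM2l.
have s16 : 16 <= s by rewrite /s ler_pdivlMr ?mulr_gt0 //; lra.
have [Q0 s0] : 0 < Q /\ 0 < s by lra.
have dY2_ge0 : 0 <= dY2 by apply: sumr_ge0 => x _; apply: sqr_ge0.
have dY2_ge : d * e <= dY2.
  rewrite -sum_dY mulr_sumr; apply: ler_sum => x _; rewrite expr2.
  have [xY|xY] := boolP (x \in Y); last by rewrite dY_out // !mulr0.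
  by apply: ler_wpM2r; [apply: le_trans (degY xY); apply: ltW|apply: degY].
have de_ge : d ^+ 2 * n <= d * e by rewrite expr2 -mulrA ler_pM2l // mulrC.
have d2n0 : 0 < d ^+ 2 * n by rewrite mulr_gt0 ?exprn_gt0.
have [/existsP[v /andP[vX ?]]|no] := boolP [exists v, (v \in X) &&
    (d ^+ 2 / 2 <= \sum_x \sum_b (fine Q s v x b)%:R)]; first by exists v.
exfalso.
have few : \sum_v \sum_b \sum_x (fine Q s v x b)%:R <= n * (d ^+ 2 / 2) :> R.
  apply: le_trans (_ : \sum_v (v \in X)%:R * (d ^+ 2 / 2) <= _); last first.
    rewrite -mulr_suml sum_ind ler_wpM2r ?cardX_le //.
    by rewrite divr_ge0 ?exprn_ge0 // ltW.
  apply: ler_sum => v _; have [vX|vX] := boolP (v \in X); last first.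
    rewrite mul0r big1 // => b _; apply: big1 => x _; rewrite /fine.
    by case: (boolP (E v x)) => [/EXY/andP[]|//]; rewrite (negPf vX).
  rewrite mul1r exchange_big /= leNgt; apply: contra no => /ltW h.
  by apply/existsP; exists v; rewrite vX.
have all_le : dY2 <= \sum_v \sum_b \sum_x (fine Q s v x b)%:R
    + (\sum_v \sum_b \sum_x pathw v b x * near v x) / Q
    + \sum_v \sum_b \sum_x (\sum_z pathw v b z < 2 * s)%R%:R * pathw v b x
    + (\sum_v \sum_b \sum_x pathw v b x * near2 v b x) / s.
  rewrite -sum_pathw !mulr_suml -!big_split; apply: ler_sum => v _ /=.
  rewrite !mulr_suml -!big_split; apply: ler_sum => b _ /=.
  rewrite !mulr_suml -!big_split; apply: ler_sum => x _ /=.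
  exact: nonfine_le.
have b1 : (\sum_v \sum_b \sum_x pathw v b x * near v x) / Q <= dY2 / 48 + d * e / 16.
  apply: le_trans (ler_wpM2r _ sum_near_le) _; first by rewrite invr_ge0 ltW.
  rewrite mulrDl; apply: lerD.
    by apply: ler_wpM2l; rewrite ?lef_pV2 ?posrE.
  rewrite (_ : 3 * n * e / Q = d * e / 16) // /Q; field.
  by rewrite !gt_eqF.
have b2 := sum_few_le s0.
have b3 : (\sum_v \sum_b \sum_x pathw v b x * near2 v b x) / s <= dY2 / 16 + 9 * n ^+ 2 / 16.
  apply: le_trans (ler_wpM2r _ sum_near2_le) _; first by rewrite invr_ge0 ltW.
  rewrite -mulrDl; apply: ler_wpM2l; last by rewrite lef_pV2 ?posrE.
  by apply: addr_ge0 => //; apply: mulr_ge0 => //; apply: sqr_ge0.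
have sE : 2 * s * n ^+ 2 = d ^+ 2 * n / 16 by rewrite /s; field; rewrite gt_eqF.
have n2 : 512 * n ^+ 2 <= d ^+ 2 * n by rewrite expr2 mulrA ler_pM2r.
lra.
Qed.

End Selection.

(** * The subgraphs [H6] and [H8] *)

Lemma adj_sym (T : finType) (G : sgraph T) : symmetric (adj G).
Proof. by move=> x y; rewrite /adj setUC. Qed.

Lemma adj_irr (T : finType) (G : sgraph T) : irreflexive (adj G).
Proof.
move=> x; apply/negP => /esetP[+ _].
by rewrite setUid cards1.
Qed.

Lemma num_edges_le_adj (T : finType) (G : sgraph T) :
  (num_edges G <= \sum_x \sum_y adj G x y)%N.
Proof.
have -> : (\sum_x \sum_y adj G x y)%N = #|[set p : T * T | adj G p.1 p.2]|.
  rewrite pair_big -sum1_card big_mkcond [RHS]big_mkcond /=.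
  by apply: eq_bigr => p _; rewrite inE; case: (adj _ _ _).
apply: leq_trans (leq_imset_card (fun p : T * T => [set p.1; p.2]) _).
apply/subset_leq_card/subsetP => f fG; have [/eqP/cards2P[x [y [_ fE]]] _] := esetP fG.
by apply/imsetP; exists (x, y); rewrite ?inE /adj -?fE.
Qed.

(** With [n] vertices, a maximum cut keeps at least [2 * n * d] edges, and the passage to minimum
    degree [d] costs at most [n * d]. *)
Lemma bipartite_min_degree (R : realFieldType) (T : finType) (G : sgraph T) (d : R) :
    0 < d -> 8 * #|vset G|%:R * d <= (num_edges G)%:R ->
  exists (E : rel T) (X Y : {set T}),
  [/\ [disjoint X & Y] /\ (#|X| + #|Y|)%:R <= #|vset G|%:R :> R,
      forall x y, E x y -> (x \in X) && (y \in Y),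
      forall x y, E x y -> [set x; y] \in eset G,
      (forall x, x \in X -> d <= \sum_y (E x y)%:R) /\
      (forall y, y \in Y -> d <= \sum_x (E x y)%:R) &
      #|vset G|%:R * d <= \sum_x \sum_y (E x y)%:R].
Proof.
move=> d0 many; have [S Scut] := max_cut (@adj_sym _ G) (@adj_irr _ G).
pose V := vset G; pose X0 := V :&: S; pose Y0 := V :\: S.
have adjV x y : adj G x y -> (x \in V) && (y \in V).
  by case/esetP => _; rewrite subUset !sub1set.
have cutE : (\sum_(x in S) \sum_(y in ~: S) adj G x y <=
    \sum_(x in X0) \sum_(y in Y0) adj G x y)%N.
  rewrite [X in (X <= _)%N]big_mkcond [X in (_ <= X)%N]big_mkcond; apply: leq_sum => x _ /=.
  rewrite inE; case: (x \in S); rewrite ?andbF // andbT.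
  have [xV|xV] := boolP (x \in V); last first.
    by rewrite big1 // => y _; case: (boolP (adj G x y)) => // /adjV/andP[]; rewrite (negPf xV).
  rewrite [X in (X <= _)%N]big_mkcond [X in (_ <= X)%N]big_mkcond; apply: leq_sum => y _ /=.
  rewrite !inE; case: (y \in S) => //=.
  by case: (boolP (adj G x y)) => [/adjV/andP[_ ->]|]; rewrite ?if_same.
have cut_ge : 2 * #|V|%:R * d <= \sum_(x in X0) \sum_(y in Y0) (adj G x y)%:R.
  have : (num_edges G)%:R <= 4 * (\sum_(x in X0) \sum_(y in Y0) adj G x y)%N%:R :> R.
    rewrite -natrM ler_nat; apply: leq_trans (num_edges_le_adj G) (leq_trans Scut _).
    by rewrite leq_mul2l.
  rewrite natr_sum; under [in X in X -> _]eq_bigr do rewrite natr_sum.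
  by rewrite -/V in many *; lra.
have cardV : (#|X0| + #|Y0| = #|V|)%N by rewrite cardsID.
pose E0 x y := [&& adj G x y, x \in X0 & y \in Y0].
have [X [Y [dX dY eXY]]] := @min_degree R T E0 X0 Y0 d.
(* As [d > 0], a vertex outside [X0], having degree zero in [E0], fails the degree bound. *)
have XX0 : X \subset X0.
  apply/subsetP => x xX; apply: contraTT (dX x xX) => xX0; rewrite -ltNge big1 // => y _.
  by rewrite /E0 (negPf xX0) andbF.
have YY0 : Y \subset Y0.
  apply/subsetP => y yY; apply: contraTT (dY y yY) => yY0; rewrite -ltNge big1 // => x _.
  by rewrite /E0 (negPf yY0) !andbF.
pose E x y := [&& E0 x y, x \in X & y \in Y].
have sumY x : x \in X -> \sum_(y in Y) (E0 x y)%:R = \sum_y (E x y)%:R :> R.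
  move=> xX; rewrite big_mkcond; apply: eq_bigr => y _.
  by rewrite /E xX; case: ifP; rewrite ?andbF ?andbT.
have sumX y : y \in Y -> \sum_(x in X) (E0 x y)%:R = \sum_x (E x y)%:R :> R.
  move=> yY; rewrite big_mkcond; apply: eq_bigr => x _.
  by rewrite /E yY; case: ifP; rewrite ?andbF ?andbT.
exists E, X, Y; split.
- split; last by rewrite ler_nat -/V -cardV leq_add ?subset_leq_card.
  rewrite -setI_eq0 -subset0; apply/subsetP => x; rewrite !inE => /andP[xX xY].
  have := subsetP XX0 x xX; have := subsetP YY0 x xY.
  by rewrite !inE => /andP[/negPf->]; rewrite andbF.
- by move=> x y /and3P[_ -> ->].
- by move=> x y /and3P[/and3P[]].
- by split=> [x xX|y yY]; [rewrite -sumY //; apply: dX|rewrite -sumX //; apply: dY].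
have -> : \sum_x \sum_y (E x y)%:R = \sum_(x in X) \sum_(y in Y) (E0 x y)%:R :> R.
  rewrite [RHS]big_mkcond; apply: eq_bigr => x _.
  have [xX|xX] := boolP (x \in X); first by rewrite sumY.
  by apply: big1 => y _; rewrite /E (negPf xX) andbF.
have e0E : \sum_(x in X0) \sum_(y in Y0) (E0 x y)%:R =
    \sum_(x in X0) \sum_(y in Y0) (adj G x y)%:R :> R.
  by apply: eq_bigr => x xX; apply: eq_bigr => y yY; rewrite /E0 xX yY !andbT.
rewrite e0E cardV in eXY.
have : 0 <= d * (#|X| + #|Y|)%:R by rewrite mulr_ge0 ?ler0n // ltW.
by move: eXY cut_ge; rewrite -/V; lra.
Qed.

Section LargeConnected.
Variables (R : realFieldType) (T : finType) (G : sgraph T) (E : rel T).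
Variables (X Y : {set T}) (n d : R).
Hypothesis disjXY : [disjoint X & Y].
Hypothesis EXY : forall x y, E x y -> (x \in X) && (y \in Y).
Hypothesis EG : forall x y, E x y -> [set x; y] \in eset G.
Hypotheses (n_gt0 : 0 < n) (d_gt0 : 0 < d).
Hypothesis degX : forall x, x \in X -> d <= \sum_y (E x y)%:R.
Hypothesis degY : forall y, y \in Y -> d <= \sum_x (E x y)%:R.
Hypothesis cardXY : (#|X| + #|Y|)%:R <= n.
Hypothesis e_ge : n * d <= \sum_x \sum_y (E x y)%:R.

(** At most [dv + du] walks are degenerate and at most [dv + du] middle edges meet a given one, so
    the surplus from [rich_pair] provides a disjoint one. *)
Lemma six_connected : 16 * n <= d ^+ 2 ->
  exists H, [/\ subgraph H G, d ^+ 3 / (2 * n) <= (num_edges H)%:R &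
               internally_cycle_connected 6 H].
Proof.
move=> large; have [v [u]] := rich_pair EXY n_gt0 d_gt0 degX degY cardXY e_ge large.
set dv := \sum_y (E v y)%:R; set du := \sum_x (E x u)%:R => walks_ge.
have [dv0 du0] : 0 <= dv /\ 0 <= du by split; apply: sumr_ge0 => ? _; apply: ler0n.
have c0 : 0 < d ^+ 3 / (2 * n) by rewrite divr_gt0 ?exprn_gt0 ?mulr_gt0.
pose m : R := \sum_b \sum_a (middle E v u b a)%:R.
have sum_diag (g : T -> R) (w : T) : \sum_b (b == w)%:R * g b = g w.
  by rewrite (bigD1 w) //= eqxx mul1r big1 ?addr0 // => b /negPf->; rewrite mul0r.
have cross : \sum_b \sum_a ((b == v)%:R * (E v a)%:R) +
     \sum_b \sum_a ((a == u)%:R * (E b u)%:R) = dv + du :> R.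
  congr (_ + _).
    by under eq_bigr do rewrite -mulr_sumr; rewrite (sum_diag (fun=> dv)).
  by apply: eq_bigr => b _; rewrite (sum_diag (fun=> (E b u)%:R)).
have walks_le : walks R E v u <= m + (dv + du).
  rewrite -cross /m -!big_split; apply: ler_sum => b _ /=.
  rewrite -!big_split; apply: ler_sum => a _ /=; rewrite /middle.
  rewrite -!natrM !mulnb -!natrD ler_nat.
  have [->|nbv] := eqVneq b v; have [->|nau] := eqVneq a u; rewrite ?andbT ?andbF /=.
  - by case: (E v u).
  - by case: (E v a); case: (E v u); rewrite ?andbF.
  - by case: (E v u); case: (E b u).
  - by case: (E v a); case: (E b a); case: (E b u).
have m_ge : d ^+ 3 / (2 * n) + (dv + du) <= m by lra.
exists (spanned G (middle_stars E v u)); split; first exact: spanned_subgraph.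
  apply: le_trans (_ : m <= _); first lra.
  rewrite /m; under eq_bigr do rewrite -natr_sum.
  by rewrite -natr_sum ler_nat (middle_stars_size disjXY EXY EG).
apply: (middle_stars_connected disjXY EXY EG) => b a Mba.
have [/existsP[b' /existsP[a' /and3P[? ? ?]]]|none] := boolP [exists b', [exists a',
  [&& middle E v u b' a', b' != b & a' != a]]]; first by exists b', a'.
suff : m <= dv + du by lra.
have <- : \sum_b' \sum_a' ((b' == b)%:R * (E v a')%:R) +
     \sum_b' \sum_a' ((a' == a)%:R * (E b' u)%:R) = dv + du :> R.
  congr (_ + _).
    by under eq_bigr do rewrite -mulr_sumr; rewrite (sum_diag (fun=> dv)).
  by apply: eq_bigr => b' _; rewrite (sum_diag (fun=> (E b' u)%:R)).
rewrite /m -big_split; apply: ler_sum => b' _ /=.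
rewrite -big_split; apply: ler_sum => a' _ /=.
rewrite -!natrM !mulnb -!natrD ler_nat.
have [M|//] := boolP (middle E v u b' a').
have [Eva' _ Ebu' _ _] := and5P M; rewrite Eva' Ebu' !andbT.
have [//|nb] := eqVneq b' b; have [//|na] := eqVneq a' a.
by case/negP: none; apply/existsP; exists b'; apply/existsP; exists a'; rewrite M nb na.
Qed.

(** [Z] consists of the neighbours of [v] close to no vertex of [U]. A fine pair [(x, b)] that is
    covered and not killed gives an edge [b x] with [x] in [Z]; these edges alone reach the
    bound. *)
Lemma eight_connected (tau : R) : 512 * n <= d ^+ 2 -> d <= n -> 0 < tau ->
    48 * n / d <= tau * (d ^+ 2 / (32 * n)) ->
  exists H, [/\ subgraph H G, d ^+ 2 / (4 * (1 + 3 * tau)) <= (num_edges H)%:R &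
               internally_cycle_connected 8 H].
Proof.
move=> large dn tau0; set Q := 48 * n / d; set s := d ^+ 2 / (32 * n) => Qs.
have [v vX fine_ge] := fine_apex EXY n_gt0 d_gt0 degY cardXY e_ge large dn.
rewrite -/Q -/s in fine_ge.
pose A := [set z | E v z].
have [|||U UA cover] := @greedy_cover R T A (close E) E (fine E Q s v) Q s tau _ tau0 Qs.
- by rewrite divr_gt0 ?exprn_gt0 ?mulr_gt0.
- move=> x b /and4P[_ _ + _]; apply: le_trans; rewrite big_mkcond; apply: ler_sum => z _.
  by rewrite inE; case: (E v z).
- move=> x b /and4P[_ _ _]; move/le_trans; apply; rewrite [X in _ <= X]big_mkcond.
  by apply: ler_sum => z _; rewrite inE; case: (E v z).
pose Z := [set x in A | ~~ killed (close E) U x].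
have AE w : w \in U :|: Z -> E v w.
  by rewrite !inE => /orP[/(subsetP UA)|/andP[]]; rewrite ?inE.
exists (spanned G (between E U Z)); split; first exact: spanned_subgraph.
  rewrite (between_size disjXY EXY EG) natr_sum.
  apply: le_trans (_ : \sum_x \sum_b
      [&& fine E Q s v x b, ~~ killed (close E) U x & covered E U b]%:R <= _).
    have t0 : 0 < 4 * (1 + 3 * tau) by lra.
    by rewrite ler_pdivrMr //; lra.
  rewrite exchange_big; apply: ler_sum => b _ /=; rewrite natr_sum.
  apply: ler_sum => x _; rewrite ler_nat.
  have [/and3P[/and4P[Evx Ebx _ _] nk cov]|//] := boolP [&& _, _ & _].
  have xZ : x \in Z by rewrite !inE Evx.
  rewrite /between Ebx inE xZ orbT -/(covered E U b) cov /=.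
  by rewrite lt0b; apply/existsP; exists x; rewrite xZ.
apply: (between_connected disjXY EXY EG (v := v)) => //.
- rewrite -setI_eq0 -subset0; apply/subsetP => x; rewrite !inE => /and3P[xU _ /negP[]].
  by apply/existsP; exists x; rewrite xU /close eqxx.
- move=> u z uU; rewrite !inE => /andP[_ nk]; rewrite leqNgt codegC.
  apply: contra nk => c4; apply/existsP; exists u.
  by rewrite uU /close c4 orbT.
Qed.

End LargeConnected.

Lemma connected_subgraphs (R : realFieldType) (tau : R) (T : finType) (G : sgraph T) (d : R) :
    let n := #|vset G|%:R in
    0 < d -> 512 * n <= d ^+ 2 -> d <= n -> 0 < tau ->
    48 * n / d <= tau * (d ^+ 2 / (32 * n)) -> 8 * n * d <= (num_edges G)%:R ->
  exists H6 H8 : sgraph T,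
    [/\ subgraph H6 G /\ subgraph H8 G,
        d ^+ 3 / (2 * n) <= (num_edges H6)%:R,
        d ^+ 2 / (4 * (1 + 3 * tau)) <= (num_edges H8)%:R,
        internally_cycle_connected 6 H6 &
        internally_cycle_connected 8 H8].
Proof.
move=> n d0 large dn tau0 Qs many.
have n0 : 0 < n by apply: lt_le_trans dn.
have [E [X [Y [[disjXY cardXY] EXY EG [degX degY] e_ge]]]] := bipartite_min_degree d0 many.
have large' : 16 * n <= d ^+ 2 by lra.
have [H6 [sub6 e6 con6]] := six_connected disjXY EXY EG n0 d0 degX degY cardXY e_ge large'.
have [H8 [sub8 e8 con8]] :=
  eight_connected disjXY EXY EG n0 d0 degY cardXY e_ge large dn tau0 Qs.
by exists H6, H8.
Qed.

Lemma large_subgraphs (R : realType) :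
  exists c6 c8 : R, [/\ 0 < c6, 0 < c8 &
    exists N : nat, forall n : nat, (N <= n)%N ->
    forall k : R, 1 <= k -> k <= n%:R `^ (1 / 3) ->
    forall (T : finType) (G : sgraph T),
      #|vset G| = n -> n%:R ^+ 2 / k <= (num_edges G)%:R ->
      exists H6 H8 : sgraph T,
        [/\ subgraph H6 G /\ subgraph H8 G,
            c6 * (n%:R ^+ 2 / k ^+ 3) <= (num_edges H6)%:R,
            c8 * (n%:R ^+ 2 / k ^+ 2) <= (num_edges H8)%:R,
            internally_cycle_connected 6 H6 &
            internally_cycle_connected 8 H8]].
Proof.
(* The condition on [tau] amounts to [48 * 32 * n ^+ 2 <= tau * d ^+ 3], and [k ^+ 3 <= n] gives
   [n ^+ 2 <= 512 * d ^+ 3]. *)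
pose tau : R := 48 * 32 * 512.
have tau0 : 0 < tau by rewrite !mulr_gt0.
have t0 : 0 < 1 + 3 * tau by lra.
(* With [d = n / (8 * k)], the factors are [1024 = 2 * 8 ^ 3] and [64 = 8 ^ 2]. *)
pose c6 : R := 1024^-1; pose c8 : R := (64 * (4 * (1 + 3 * tau)))^-1.
exists c6, c8; split; first by rewrite invr_gt0.
  by rewrite invr_gt0 !mulr_gt0.
pose M : R := 512 ^+ 5; have M0 : 0 <= M by apply: exprn_ge0.
exists (Num.bound M) => n nM k k1 kn T G Gn many.
have Mn : M < n%:R by apply: lt_le_trans (archi_boundP M0) _; rewrite ler_nat.
have n0 : 0 < n%:R :> R by apply: le_lt_trans Mn.
have k0 : 0 < k by apply: lt_le_trans k1.
have k3 : k ^+ 3 <= n%:R.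
  have -> : n%:R = (n%:R `^ (1 / 3)) ^+ 3 :> R.
    by rewrite -powR_mulrn ?powR_ge0 // -powRrM divfK ?pnatr_eq0 // powRr1.
  by apply: lerXn2r kn; rewrite nnegrE ?powR_ge0 // ltW.
pose d : R := n%:R / (8 * k).
have dk : 8 * k * d = n%:R by rewrite /d mulrC divfK // gt_eqF // mulr_gt0.
have d0 : 0 < d by rewrite divr_gt0 // mulr_gt0.
have d3 : n%:R ^+ 2 <= 512 * d ^+ 3.
  have -> : 512 * d ^+ 3 = n%:R ^+ 2 * (n%:R / k ^+ 3).
    by rewrite /d; field; rewrite gt_eqF.
  by rewrite ler_peMr ?sqr_ge0 // ler_pdivlMr ?exprn_gt0 // mul1r.
have dn : d <= n%:R.
  rewrite /d ler_pdivrMr ?mulr_gt0 // ler_peMr //; lra.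
(* Otherwise [n ^+ 4 <= 512 ^+ 2 * d ^+ 6 <= 512 ^+ 5 * n ^+ 3], against [M < n]. *)
have large : 512 * n%:R <= d ^+ 2.
  rewrite leNgt; apply/negP => small.
  have h1 : (d ^+ 2) ^+ 3 <= (512 * n%:R) ^+ 3.
    by apply: lerXn2r (ltW small); rewrite nnegrE ?sqr_ge0 ?mulr_ge0.
  have h2 : (n%:R ^+ 2) ^+ 2 <= (512 * d ^+ 3) ^+ 2.
    apply: lerXn2r d3; rewrite nnegrE; first exact: sqr_ge0.
    by apply: mulr_ge0 => //; apply: exprn_ge0; apply: ltW.
  have h3 : n%:R ^+ 3 * n%:R <= n%:R ^+ 3 * M.
    have -> : n%:R ^+ 3 * M = 512 ^+ 2 * (512 * n%:R) ^+ 3 by rewrite /M; ring.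
    have -> : n%:R ^+ 3 * n%:R = (n%:R ^+ 2) ^+ 2 :> R by ring.
    apply: le_trans h2 _.
    have -> : (512 * d ^+ 3) ^+ 2 = 512 ^+ 2 * (d ^+ 2) ^+ 3 by ring.
    by rewrite ler_wpM2l ?exprn_ge0.
  by move: h3; rewrite ler_pM2l ?exprn_gt0 // leNgt Mn.
have Qs : 48 * n%:R / d <= tau * (d ^+ 2 / (32 * n%:R)).
  rewrite ler_pdivrMr // (_ : _ * d = tau * d ^+ 3 / (32 * n%:R)); last by ring.
  rewrite ler_pdivlMr ?mulr_gt0 //.
  have -> : 48 * n%:R * (32 * n%:R) = 48 * 32 * n%:R ^+ 2 :> R by ring.
  have -> : tau * d ^+ 3 = 48 * 32 * (512 * d ^+ 3) by rewrite /tau; ring.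
  by rewrite ler_wpM2l ?mulr_ge0.
have many' : 8 * n%:R * d <= (num_edges G)%:R.
  apply: le_trans many; rewrite (_ : 8 * n%:R * d = n%:R ^+ 2 / k) //.
  by rewrite /d; field; rewrite gt_eqF.
have [H6 [H8 [sub e6 e8 con6 con8]]] :
    exists H6 H8 : sgraph T,
    [/\ subgraph H6 G /\ subgraph H8 G,
        d ^+ 3 / (2 * n%:R) <= (num_edges H6)%:R,
        d ^+ 2 / (4 * (1 + 3 * tau)) <= (num_edges H8)%:R,
        internally_cycle_connected 6 H6 &
        internally_cycle_connected 8 H8].
  by rewrite -Gn; apply: connected_subgraphs; rewrite // Gn.
exists H6, H8; split=> //.
  apply: le_trans e6; rewrite (_ : c6 * _ = d ^+ 3 / (2 * n%:R)) //.
  by rewrite /c6 /d; field; rewrite !gt_eqF.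
apply: le_trans e8; rewrite (_ : c8 * _ = d ^+ 2 / (4 * (1 + 3 * tau))) //.
by rewrite /c8 /d; field; rewrite !gt_eqF.
Qed.

Theorem theorem1p2 (R : realType) :
  (exists c6 c8 : R, [/\ 0 < c6, 0 < c8 &
    exists N : nat, forall n : nat, (N <= n)%N ->
    forall k : R, 1 <= k -> k <= n%:R `^ (1 / 3) ->
    forall (T : finType) (G : sgraph T),
      #|vset G| = n ->
      n%:R ^+ 2 / k <= (num_edges G)%:R ->
      exists H6 H8 : sgraph T,
        [/\ subgraph H6 G /\ subgraph H8 G,
            c6 * (n%:R ^+ 2 / k ^+ 3) <= (num_edges H6)%:R,
            c8 * (n%:R ^+ 2 / k ^+ 2) <= (num_edges H8)%:R,
            internally_cycle_connected 6 H6 &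
            internally_cycle_connected 8 H8]])
  /\
  (exists d6 d8 : R, [/\ 0 < d6, 0 < d8 &
    forall beta : R, 0 < beta -> beta <= 1 / 3 ->
    exists N : nat, forall n : nat, (N <= n)%N ->
    forall (T : finType) (G : sgraph T),
      #|vset G| = n ->
      n%:R `^ (2 - beta) <= (num_edges G)%:R ->
      exists H6 H8 : sgraph T,
        [/\ subgraph H6 G /\ subgraph H8 G,
            d6 * n%:R `^ (2 - 3 * beta) <= (num_edges H6)%:R,
            d8 * n%:R `^ (2 - 2 * beta) <= (num_edges H8)%:R,
            internally_cycle_connected 6 H6 &
            internally_cycle_connected 8 H8]]).
Proof.
have [c6 [c8 [c60 c80 [N HN]]]] := large_subgraphs R.
split; first by exists c6, c8; split=> //; exists N.
(* The first part is applied with [k] equal to [n] to the power [beta]; the threshold is the same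
   for every [beta], and the maximum with 1 makes [n] positive. *)
exists c6, c8; split=> // beta beta0 beta3; exists (maxn N 1) => n.
rewrite geq_max => /andP[Nn n1] T G Gn many.
have n0 : 0 < n%:R :> R by rewrite ltr0n.
have n0' : (n%:R : R) != 0 by rewrite gt_eqF.
have n1' : 1 <= n%:R :> R by rewrite ler1n.
have powB m : n%:R `^ (2 - m%:R * beta) = n%:R ^+ 2 / (n%:R `^ beta) ^+ m.
  rewrite powRB ?n0' ?implybT //.
  by rewrite powR_mulrn ?ler0n // [m%:R * _]mulrC powRrM powR_mulrn ?powR_ge0.
rewrite -[X in 2 - X]mul1r (powB 1%N) expr1 in many.
rewrite (powB 2%N) (powB 3%N).
apply: HN many => //.
  by have := ler_powR n1' (ltW beta0); rewrite powRr0.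
by rewrite ler_powR.
Qed.
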